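(* Let $(\mathfrak{P}_n)_{n\ge 1}$ be the sequence of sets of polytopes defined recursively as follows. Put $\mathfrak{P}_1=\{[0,1]\}$. Given $\mathfrak{P}_n$, let $\mathfrak{P}_{n+1}$ be the set of all polytopes $Q\subset\mathbb{R}^{n+1}$ for which there exists $P\in\mathfrak{P}_n$ such that either (a) $Q=P\times[0,1]$, or (b) $Q$ is the 0/1-polytope with vertex set $$V(Q)=\pi_0^{-1}(U)\cup\pi_1^{-1}(V(P)\setminus U)$$ for some subgroup $U$ of $(V(P),\oplus)$ with index $|V(P):U|=2$ and $U\neq U_i$ for all $1\le i\le n$, where $U_i=V(P)\cap H_i$. Then for all $n\in\mathbb{N}$, $n\geq 1$, the set $\mathfrak{P}_n$ consists of exactly all 0/1-polytopes $P\subset\mathbb{R}^n$ that satisfy both of the following conditions: (I) $(V(P),\oplus)$ is a subgroup of $(W_n,\oplus)$; (II) $P$ has dimension $n$.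
   Context: For a convex polytope $P$, $V(P)$ denotes its vertex set. $W_n=\{0,1\}^n\subset\mathbb{R}^n$, and $\oplus$ denotes componentwise addition modulo 2 on $W_n$, so that $(W_n,\oplus)$ is an abelian group isomorphic to $(\mathbb{F}_2^n,+)$. A 0/1-polytope in $\mathbb{R}^n$ is a polytope $P\subset\mathbb{R}^n$ with $V(P)\subseteq W_n$. The bijections $\pi_0:\mathbb{R}^n\times\{0\}\to\mathbb{R}^n$ and $\pi_1:\mathbb{R}^n\times\{1\}\to\mathbb{R}^n$ are given by $\pi_0(x_1,\dots,x_n,0)=(x_1,\dots,x_n)$ and $\pi_1(x_1,\dots,x_n,1)=(x_1,\dots,x_n)$. For $1\le i\le n$, $H_i=\{(x_1,\dots,x_n)\in\mathbb{R}^n: x_i=0\}$. *)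

(* Defs.v *)
From mathcomp Require Export all_boot all_order all_algebra.
From mathcomp Require Export boolp classical_sets functions cardinality reals.

Set Implicit Arguments.
Unset Strict Implicit.
Unset Printing Implicit Defensive.

Import Order.TTheory GRing.Theory Num.Theory.

Local Open Scope classical_set_scope.
Local Open Scope ring_scope.

Section Polytopes.
Context {R : realType} {n : nat}.
Implicit Types P S : set 'rV[R]_n.

Definition conv_hull S : set 'rV[R]_n :=
  [set x | exists (m : nat) (w : 'I_m -> R) (p : 'I_m -> 'rV[R]_n),
    [/\ forall i, 0 <= w i, \sum_i w i = 1, forall i, S (p i)
      & x = \sum_i w i *: p i]].

Definition aff_hull S : set 'rV[R]_n :=
  [set x | exists (m : nat) (w : 'I_m -> R) (p : 'I_m -> 'rV[R]_n),
    [/\ \sum_i w i = 1, forall i, S (p i) & x = \sum_i w i *: p i]].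

Definition polytope P : Prop :=
  exists2 S : set 'rV[R]_n, finite_set S & P = conv_hull S.

(* The vertices of a convex polytope are its extreme points. *)
Definition vertices P : set 'rV[R]_n :=
  [set v | P v /\ forall (x y : 'rV[R]_n) (t : R), P x -> P y -> 0 < t < 1 ->
    v = (1 - t) *: x + t *: y -> x = v /\ y = v].

(* The affine hull is a translate of a d-dimensional linear subspace; no [d]
   qualifies when [P] is empty. *)
Definition has_dim P (d : nat) : Prop :=
  exists (x0 : 'rV[R]_n) (D : {vspace 'rV[R]_n}),
    \dim D = d /\ aff_hull P = [set x | x - x0 \in D].

Definition W : set 'rV[R]_n := [set x | forall i, x 0 i = 0 \/ x 0 i = 1].

Definition polytope01 P : Prop := polytope P /\ vertices P `<=` W.

(* Componentwise addition modulo 2; only meaningful for [x] and [y] in [W]. *)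
Definition addW (x y : 'rV[R]_n) : 'rV[R]_n :=
  \row_i (if x 0 i + y 0 i == 2 then 0 else x 0 i + y 0 i).

(* [H] is a subgroup of [G] for [addW], where [G] is a subset of [W]. *)
Definition subgroupW (H G : set 'rV[R]_n) : Prop :=
  [/\ H `<=` G, H 0, forall x y, H x -> H y -> H (addW x y)
    & forall x, H x -> exists2 y, H y & addW x y = 0].

Definition cosetsW (G H : set 'rV[R]_n) : set (set 'rV[R]_n) :=
  [set addW x @` H | x in G].

Definition indexW (G H : set 'rV[R]_n) (k : nat) : Prop :=
  (cosetsW G H #= `I_k)%card.

Definition hyperplane0 (i : 'I_n) : set 'rV[R]_n := [set x | x 0 i = 0].

End Polytopes.

Arguments W {R} n.

Section Product.
Context {R : realType} {n : nat}.

Definition last_coord (y : 'rV[R]_n.+1) : R := y 0 ord_max.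

Definition drop_last (y : 'rV[R]_n.+1) : 'rV[R]_n :=
  \row_(i < n) y 0 (lift ord_max i).

(* The inverse image of [U] under the bijection from R^n x {e} to R^n that
   forgets the last coordinate. *)
Definition preim_pi (e : R) (U : set 'rV[R]_n) : set 'rV[R]_n.+1 :=
  [set y | last_coord y = e /\ U (drop_last y)].

Definition prod01 (P : set 'rV[R]_n) : set 'rV[R]_n.+1 :=
  [set y | P (drop_last y) /\ 0 <= last_coord y <= 1].

Definition step_b (P : set 'rV[R]_n) (Q : set 'rV[R]_n.+1) : Prop :=
  polytope01 Q /\
  exists U : set 'rV[R]_n,
    [/\ subgroupW U (vertices P),
        indexW (vertices P) U 2%N,
        forall i : 'I_n, U <> vertices P `&` hyperplane0 i
      & vertices Q = preim_pi 0 U `|` preim_pi 1 (vertices P `\` U)].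

End Product.

(* The sequence starts at index 1; the value at 0 is a placeholder. *)
Fixpoint frakP (R : realType) (n : nat) : set (set 'rV[R]_n) :=
  match n return set (set 'rV[R]_n) with
  | 0 => set0
  | m.+1 =>
    match m return set (set 'rV[R]_m) -> set (set 'rV[R]_m.+1) with
    | 0 => fun=> [set [set x : 'rV[R]_1 | 0 <= x 0 0 <= 1]]
    | k.+1 => fun frakPm =>
        [set Q | polytope Q /\
          exists2 P, frakPm P & Q = prod01 P \/ step_b P Q]
    end (@frakP R m)
  end.

Arguments frakP : clear implicits.

(* Main.v *)
Require Import Defs.
From mathcomp Require Import ring lra.

(* A 0/1-polytope is determined by its vertex set, and every subset of [W] is
   the vertex set of its convex hull. A subgroup [V] of [W] spans a polytope of
   full dimension if and only if the coordinates, as functions on [V], are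
   nonzero and pairwise distinct: they are (1 - chi) / 2 for characters chi of
   [V], and distinct characters are linearly independent. Now forget the last
   coordinate of such a subgroup [S] of rank n + 1: its image [V] in dimension n
   is again of this kind, and either [S] contains the last unit vector, so that
   [S = V x {0, 1}], or the last coordinate is a homomorphism on [V], which is
   determined by its kernel [U]. That this homomorphism is nonzero means that
   [U] has index 2, and that it differs from the i-th coordinate means that
   [U <> U_i]. *)

Set Implicit Arguments.
Unset Strict Implicit.
Unset Printing Implicit Defensive.

Import Order.TTheory GRing.Theory Num.Theory.

Local Open Scope classical_set_scope.
Local Open Scope ring_scope.

(** * Convex hulls, extreme points and 0/1-points *)

Section Convexity.
Context {R : realType} {n : nat}.
Implicit Types (C S T P : set 'rV[R]_n) (x y z v p : 'rV[R]_n) (t : R).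

Definition is_convex C : Prop := forall x y t,
  C x -> C y -> 0 <= t <= 1 -> C ((1 - t) *: x + t *: y).

Lemma sub_conv_hull S : S `<=` conv_hull S.
Proof.
move=> x Sx; exists 1%N, (fun=> 1), (fun=> x); split=> //.
- by rewrite big_ord1.
- by rewrite big_ord1 scale1r.
Qed.

Lemma convex_conv_hull S : is_convex (conv_hull S).
Proof.
move=> _ _ t [m [w [p [w0 w1 Sp ->]]]] [k [u [q [u0 u1 Sq ->]]]] /andP[t0 t1].
pose f (i : 'I_(m + k)) :=
  match fintype.split i with inl j => (1 - t) * w j | inr j => t * u j end.
pose g (i : 'I_(m + k)) := match fintype.split i with inl j => p j | inr j => q j end.
exists (m + k)%N, f, g; split.
- by move=> i; rewrite /f; case: fintype.split => j; rewrite mulr_ge0 ?subr_ge0.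
- rewrite big_split_ord /=.
  under eq_bigr do rewrite /f (unsplitK (inl _)).
  under [X in _ + X]eq_bigr do rewrite /f (unsplitK (inr _)).
  by rewrite -!mulr_sumr w1 u1; ring.
- by move=> i; rewrite /g; case: fintype.split.
- rewrite big_split_ord /= !scaler_sumr; congr (_ + _); apply: eq_bigr => i _;
    by rewrite scalerA /f /g ?(unsplitK (inl _)) ?(unsplitK (inr _)).
Qed.

(** Induction on the number of points: split off the first one and rescale the other weights by
    their sum [s], so that a single two-point combination remains. *)
Lemma conv_hull_min S C : is_convex C -> S `<=` C -> conv_hull S `<=` C.
Proof.
move=> cC SC x [m [w [p [w0 w1 Sp ->]]]].
elim: m w p w0 w1 Sp => [|m IH] w p w0 w1 Sp.
  by move: w1; rewrite big_ord0 => /esym/eqP; rewrite oner_eq0.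
rewrite big_ord_recl; move: w1; rewrite big_ord_recl => w1.
have s0 : 0 <= \sum_(i < m) w (lift ord0 i) by rewrite sumr_ge0.
set s := (X in _ + X = _) in w1 s0.
(* Rescaling needs [s] nonzero; if [s = 0], all weights after the first vanish, being
   nonnegative. *)
have [s_eq0|s_neq0] := eqVneq s 0.
  have w00 : w ord0 = 1 by move: w1; rewrite s_eq0 addr0.
  rewrite big1 ?addr0 ?w00 ?scale1r; first exact/SC/Sp.
  move=> i _; suff -> : w (lift ord0 i) = 0 by rewrite scale0r.
  exact: (psumr_eq0P (fun j _ => w0 (lift ord0 j)) s_eq0).
have -> : w ord0 = 1 - s by rewrite -w1; ring.
have -> : \sum_(i < m) w (lift ord0 i) *: p (lift ord0 i) =
    s *: \sum_(i < m) (w (lift ord0 i) / s) *: p (lift ord0 i).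
  by rewrite scaler_sumr; apply: eq_bigr => i _; rewrite scalerA mulrC divfK.
apply: cC; first exact/SC/Sp.
- apply: IH => // [i|]; first by rewrite divr_ge0.
  by rewrite -mulr_suml divff.
- by rewrite s0 /=; have := w0 ord0; lra.
Qed.

Lemma conv_hull_mono S T : S `<=` conv_hull T -> conv_hull S `<=` conv_hull T.
Proof. by move=> ST; apply: conv_hull_min => //; exact: convex_conv_hull. Qed.

(** Removing an extreme point [v] from a convex set leaves it convex. If [v] were not in [S], the
    remaining set would contain [S], hence the whole hull, hence [v] itself. *)
Lemma vertices_conv_hull_sub S : vertices (conv_hull S) `<=` S.
Proof.
move=> v [Sv ext]; apply: contrapT => nSv.
suff: (conv_hull S `\ v) v by case=> _ /(_ erefl).
apply: (@conv_hull_min S) => //; last first.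
  move=> x Sx; split; first exact: sub_conv_hull.
  by move=> /= xv; apply: nSv; rewrite -xv.
move=> x y t [Sx xv] [Sy yv] t01; split; first exact: convex_conv_hull.
move=> /= /esym e; have [t0|t0] := eqVneq t 0.
  by apply: xv; rewrite /= e t0; apply/rowP => i; rewrite !mxE; ring.
have [t1|t1] := eqVneq t 1.
  by apply: yv; rewrite /= e t1; apply/rowP => i; rewrite !mxE; ring.
have [|xe _] := ext x y t Sx Sy _ e; last exact: xv.
by rewrite !lt_neqAle eq_sym t0 t1.
Qed.

(** The join of [p] with the hull of the other points is convex and contains [S]. The point [p] is a
    separate alternative because the hull of the other points may be empty. *)
Lemma conv_hull_setD1P S p x : conv_hull S x ->
  x = p \/ exists a z, [/\ 0 <= a < 1, conv_hull (S `\ p) z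
                         & x = a *: p + (1 - a) *: z].
Proof.
pose C := [set x | x = p \/ exists a z, [/\ 0 <= a < 1, conv_hull (S `\ p) z
                         & x = a *: p + (1 - a) *: z]].
suff: conv_hull S `<=` C by move=> /[apply].
apply: conv_hull_min; last first.
  move=> y Sy; case: (pselect (y = p)) => [->|yp]; [by left|right].
  exists 0, y; split; first by rewrite lexx ltr01.
    by apply: sub_conv_hull; split.
  by rewrite scale0r add0r subr0 scale1r.
have mix b y c z t : 0 <= t <= 1 -> 0 <= b <= 1 -> 0 <= c <= 1 ->
    (b < 1 -> conv_hull (S `\ p) y) -> (c < 1 -> conv_hull (S `\ p) z) ->
    C ((1 - t) *: (b *: p + (1 - b) *: y) + t *: (c *: p + (1 - c) *: z)).
  move=> t01 b01 c01 Hy Hz.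
  (* [d] is the total weight that the combination puts on [y] and [z]; if it is zero, only [p]
     remains. *)
  set d := (1 - t) * (1 - b) + t * (1 - c).
  have [d0|d0] := eqVneq d 0.
    left; have [e1 e2] : (1 - t) * (1 - b) = 0 /\ t * (1 - c) = 0.
      by rewrite /d in d0; split; nra.
    apply/rowP => i; rewrite !mxE.
    transitivity (p 0 i + ((1 - t) * (1 - b)) * (y 0 i - p 0 i)
       + (t * (1 - c)) * (z 0 i - p 0 i)); first by ring.
    by rewrite e1 e2; ring.
  have d01 : 0 < d <= 1 by rewrite lt_def d0 /= /d; apply/andP; split; nra.
  right; exists (1 - d), ((1 - t * (1 - c) / d) *: y + (t * (1 - c) / d) *: z).
  split; first by lra.
    have [b1|b1] := eqVneq b 1.
      have -> : t * (1 - c) / d = 1.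
        by rewrite -[t * (1 - c)](_ : d = _) ?divff // /d b1; ring.
      rewrite subrr scale0r add0r scale1r; apply: Hz.
      rewrite lt_neqAle; case/andP: c01 => _ ->; rewrite andbT.
      by apply: contra_neq d0 => c1; rewrite /d b1 c1; ring.
    have [c1|c1] := eqVneq c 1.
      rewrite c1 subrr mulr0 mul0r subr0 scale1r scale0r addr0; apply: Hy.
      by rewrite lt_neqAle b1; case/andP: b01.
    apply: convex_conv_hull.
    - by apply: Hy; rewrite lt_neqAle b1; case/andP: b01.
    - by apply: Hz; rewrite lt_neqAle c1; case/andP: c01.
    - case/andP: d01 => dp _.
      by rewrite ler_pdivlMr // ler_pdivrMr // /d; apply/andP; split; nra.
  by apply/rowP => i; rewrite !mxE; move: d0; rewrite /d => d0; field.
(* A uniform shape for both alternatives: [b = 1] stands for [p] itself, and then nothing is asked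
   of [y]. *)
have rep x' : C x' -> exists b y, [/\ 0 <= b <= 1,
    b < 1 -> conv_hull (S `\ p) y & x' = b *: p + (1 - b) *: y].
  case=> [->|[a [z [a01 Sz ->]]]].
    exists 1, p; rewrite ltxx; split=> //; first by rewrite ler01 lexx.
    by rewrite subrr scale0r addr0 scale1r.
  by exists a, z; split=> //; lra.
move=> _ _ t /rep[b [y [b01 Hy ->]]] /rep[c [z [c01 Hz ->]]] t01.
exact: mix.
Qed.

(** If [p] lay strictly between [x] and [y], both different from [p], then writing each as a mixture
    of [p] with a point of the hull of [S] without [p] and cancelling [p] would put [p] into that
    hull. *)
Lemma vertex_conv_hull S p :
  S p -> ~ conv_hull (S `\ p) p -> vertices (conv_hull S) p.
Proof.
move=> Sp np; split; first exact: sub_conv_hull.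
move=> x y t Sx Sy t01 e.
(* As [0 < t < 1], if one endpoint equals [p], so does the other. *)
have xy : x = p -> y = p.
  move=> xp; apply/rowP => i; move/rowP: e => /(_ i); rewrite xp !mxE => e.
  have : t * (y 0 i - p 0 i) = 0 by rewrite mulrBr; lra.
  by move=> /eqP; rewrite mulf_eq0 subr_eq0 => /orP[/eqP t0|/eqP//]; lra.
have yx : y = p -> x = p.
  move=> yp; apply/rowP => i; move/rowP: e => /(_ i); rewrite yp !mxE => e.
  have : (1 - t) * (x 0 i - p 0 i) = 0 by rewrite mulrBr; lra.
  by move=> /eqP; rewrite mulf_eq0 subr_eq0 => /orP[/eqP t0|/eqP//]; lra.
have [xp|[a [x' [a01 Hx xE]]]] := conv_hull_setD1P p Sx; first by split=> //; apply: xy.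
have [yp|[b [y' [b01 Hy yE]]]] := conv_hull_setD1P p Sy; first by split=> //; apply: yx.
case: np.
pose d := (1 - t) * (1 - a) + t * (1 - b).
have d0 : 0 < d by rewrite /d; nra.
have dn0 : d != 0 by rewrite gt_eqF.
have pE : p = (1 - t * (1 - b) / d) *: x' + (t * (1 - b) / d) *: y'.
  apply: (scalerI dn0); apply/rowP => i.
  move/rowP: e => /(_ i); rewrite xE yE !mxE => e.
  transitivity ((1 - t) * (1 - a) * x' 0 i + t * (1 - b) * y' 0 i).
    by rewrite /d; lra.
  by move: dn0; rewrite /d => dn0; field.
rewrite {2}pE; apply: convex_conv_hull => //.
by rewrite ler_pdivlMr // ler_pdivrMr // /d; apply/andP; split; nra.
Qed.

(** Minkowski's theorem for polytopes. Discard generators that lie in the hull of the others, by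
    induction on their number; once none is redundant, every generator is a vertex. *)
Lemma conv_hull_vertices P : polytope P -> conv_hull (vertices P) = P.
Proof.
case=> S /finite_seqP[s ->] ->{P S}.
have [k] := ubnP (size s); elim: k s => // k IH s sk.
case: (pselect (exists2 p, p \in s & conv_hull ([set` s] `\ p) p)).
  case=> p ps Hp.
  have e : [set` s] `\ p = [set` [seq x <- s | x != p]].
    by apply/seteqP; split=> x /=; rewrite mem_filter;
      [move=> [-> /eqP ->]|move=> /andP[/eqP ? ->]].
  have -> : conv_hull [set` s] = conv_hull [set` [seq x <- s | x != p]].
    apply/seteqP; split; apply: conv_hull_mono => x /= xs; last first.
      by apply: sub_conv_hull; move: xs; rewrite /= mem_filter => /andP[].
    have [->|xp] := eqVneq x p; first by rewrite -e.
    by apply: sub_conv_hull; rewrite /= mem_filter xp.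
  apply: IH; rewrite ltnS in sk; apply: leq_trans sk.
  rewrite size_filter -(count_predC (pred1 p)) -add1n leq_add2r.
  by rewrite -has_count has_pred1.
move=> H; apply/seteqP; split.
  by apply: conv_hull_mono => x [].
apply: conv_hull_min; first exact: convex_conv_hull.
move=> x /= xs; apply: sub_conv_hull; apply: vertex_conv_hull => // Hx.
by apply: H; exists x.
Qed.

(** The hull lies in the unit cube, and each coordinate of a 0/1-point is an endpoint of [[0, 1]],
    so no proper segment in the cube passes through it. *)
Lemma vertices_conv_hullW S : S `<=` W n -> vertices (conv_hull S) = S.
Proof.
move=> SW; apply/seteqP; split; first exact: vertices_conv_hull_sub.
move=> v Sv; split; first exact: sub_conv_hull.
have cube : conv_hull S `<=` [set x | forall i, 0 <= x 0 i <= 1].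
  apply: conv_hull_min => [x y t Hx Hy t01 i|x Sx i].
    by rewrite !mxE; have := Hx i; have := Hy i; rewrite /=; nra.
  by case: (SW _ Sx i) => ->; rewrite lexx ler01.
move=> x y t /cube Hx /cube Hy t01 e.
suff H i : x 0 i = v 0 i /\ y 0 i = v 0 i by split; apply/rowP => i; case: (H i).
move/rowP: e => /(_ i); rewrite !mxE => e.
have := Hx i; have := Hy i; move=> /andP[y0 y1] /andP[x0 x1].
by case: (SW _ Sv i) => v01; rewrite v01 in e *; split; nra.
Qed.

Lemma finite_W : finite_set (@W R n).
Proof.
apply: (@sub_finite_set _ _
  ((fun b : 'rV[bool]_n => \row_i (b 0 i)%:R : 'rV[R]_n) @` setT)).
  move=> x Wx; exists (\row_i (x 0 i == 1)) => //.
  apply/rowP => i; rewrite !mxE.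
  by case: (Wx i) => ->; rewrite ?eqxx // eq_sym oner_eq0.
exact/finite_image/finite_finset.
Qed.

Lemma polytope_conv_hullW S : S `<=` W n -> polytope (conv_hull S).
Proof. by move=> SW; exists S => //; exact: sub_finite_set finite_W. Qed.

End Convexity.

(** * Full dimension in terms of the coordinate functions *)

Section Dimension.
Context {R : realType} {n : nat}.
Implicit Types (S P : set 'rV[R]_n) (x y : 'rV[R]_n).

(** The combinatorial form of full dimension for subgroups of [W n]. *)
Definition separated S : Prop :=
  (forall i, exists2 x, S x & x 0 i <> 0) /\
  (forall i j, i != j -> exists2 x, S x & x 0 i <> x 0 j).

Lemma has_dim_full P : has_dim P n <-> aff_hull P = setT.
Proof.
split=> [[x0 [D [dD ->]]]|PT].
  have -> : D = fullv.
    by apply/eqP; rewrite eqEdim subvf dimvf dD /dim /= mul1n leqnn.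
  by apply/seteqP; split=> x //= _; exact: memvf.
exists 0, fullv; split; first by rewrite dimvf /dim /= mul1n.
by rewrite PT; apply/seteqP; split=> x //= _; exact: memvf.
Qed.

Lemma aff_hull_mulmx0 (c : 'cV[R]_n) P :
  (forall x, P x -> x *m c = 0) -> forall x, aff_hull P x -> x *m c = 0.
Proof.
move=> cP _ [m [w [p [w1 Pp ->]]]].
by rewrite mulmx_suml big1 // => i _; rewrite -scalemxAl cP // scaler0.
Qed.

Lemma conv_hull_aff_hull S : conv_hull S `<=` aff_hull S.
Proof. by move=> x [m [w [p [_ w1 Sp ->]]]]; exists m, w, p. Qed.

Lemma addWxx x : W n x -> addW x x = 0.
Proof.
move=> Wx; apply/rowP => i; rewrite !mxE.
by case: (Wx i) => ->; rewrite ?addr0 ?eqxx // eq_sym pnatr_eq0.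
Qed.

(** Bit vectors form a finite group under exclusive or, over which sums can be taken; [emb] carries
    them to 0/1-points. *)
Let emb (b : 'rV[bool]_n) : 'rV[R]_n := \row_i (b 0 i)%:R.

Let emb_surj x : W n x -> exists b, x = emb b.
Proof.
move=> Wx; exists (\row_i (x 0 i == 1)); apply/rowP => i; rewrite !mxE.
by case: (Wx i) => ->; rewrite ?eqxx // eq_sym oner_eq0.
Qed.

Let embD b c : emb (b + c) = addW (emb b) (emb c).
Proof.
apply/rowP => i; rewrite !mxE -[b 0 i + c 0 i]/(b 0 i (+) c 0 i).
case: (b 0 i) (c 0 i) => [] [] /=; rewrite ?addr0 ?add0r ?eqxx //.
- by rewrite eq_sym -subr_eq0 -[2]/(1 + 1) addrK oner_eq0.
- by rewrite eq_sym -subr_eq0 -[2]/(1 + 1) addrK oner_eq0.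
- by rewrite eq_sym pnatr_eq0.
Qed.

(* With [chi i x = (-1) ^ (x i) = 1 - 2 (x i)], separation says that the
   characters [chi i] of [S] are nontrivial and pairwise distinct, so by
   orthogonality [sum_(x in S) chi j x * x i = - #|S| / 2] if [i = j], and [0]
   otherwise; hence every vector is a combination of [S]. *)
Lemma separated_aff_hull S :
  subgroupW S (W n) -> separated S -> aff_hull S = setT.
Proof.
case=> SW S0 SD _ [sep1 sep2]; apply/seteqP; split=> // x _.
pose G := [set b | `[< S (emb b) >]]%SET.
have GP b : reflect (S (emb b)) (b \in G).
  by rewrite finset.in_set; exact: asboolP.
have SG z : S z -> exists2 b, b \in G & z = emb b.
  move=> Sz; have [b zE] := emb_surj (SW _ Sz).
  by exists b => //; apply/GP; rewrite -zE.
have GD b c : b \in G -> c \in G -> b + c \in G.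
  by move=> /GP Sb /GP Sc; apply/GP; rewrite embD; exact: SD.
have emb0 : emb 0 = 0 by apply/rowP => i; rewrite !mxE.
have G0 : 0 \in G by apply/GP; rewrite emb0.
pose chi i (b : 'rV[bool]_n) : R := (-1) ^+ b 0 i.
have chiD i b c : chi i (b + c) = chi i b * chi i c.
  by rewrite /chi mxE signr_addb.
have chiE i b : (emb b) 0 i = (1 - chi i b) / 2.
  by rewrite mxE /chi; case: (b 0 i); rewrite ?expr1 ?expr0 /=; field.
have bb (b : 'rV[bool]_n) : b + b = 0.
  by apply/rowP => i; rewrite !mxE; exact: addbb.
(* Translation by [c] permutes [G] and multiplies the sum by [f c], which differs from 1. *)
have ortho (f : 'rV[bool]_n -> R) : (forall b c, f (b + c) = f b * f c) ->
    (exists2 b, b \in G & f b <> 1) -> \sum_(b in G) f b = 0.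
  move=> fD [c cG fc].
  have : \sum_(b in G) f b = f c * \sum_(b in G) f b.
    rewrite {1}(reindex_onto (fun b => c + b) (fun b => c + b)) /=; last first.
      by move=> b _; rewrite addrA bb add0r.
    rewrite mulr_sumr; apply: eq_big => [b|b _]; last exact: fD.
    rewrite addrA bb add0r eqxx andbT; apply/idP/idP => [cb|]; last exact: GD.
    by rewrite -[b]add0r -(bb c) -addrA GD.
  move=> /eqP; rewrite -{1}[\sum_(_ in _) _]mul1r -subr_eq0 -mulrBl mulf_eq0.
  by rewrite subr_eq0 eq_sym => /orP[/eqP//|/eqP].
have chi0 i : \sum_(b in G) chi i b = 0.
  apply: ortho => //; have [z Sz zi] := sep1 i.
  have [b bG zE] := SG _ Sz; exists b => // b1.
  by apply: zi; rewrite zE chiE b1 subrr mul0r.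
have chi_chi i j : \sum_(b in G) chi i b * chi j b = (#|G| * (i == j))%:R.
  have [<-|ij] := eqVneq i j; rewrite ?muln1 ?muln0.
    under eq_bigr do rewrite -signr_addb addbb.
    by rewrite sumr_const.
  apply: ortho => [b c|]; first by rewrite !chiD; ring.
  have [z Sz zij] := sep2 _ _ ij.
  have [b bG zE] := SG _ Sz; exists b => // b1.
  apply: zij; rewrite zE !chiE; congr ((1 - _) / _).
  by move: b1; rewrite /chi; case: (b 0 i); case: (b 0 j);
    rewrite //= ?expr0 ?expr1 ?mulr1 ?mul1r => ->.
have G_neq0 : #|G|%:R != 0 :> R.
  by rewrite pnatr_eq0 -lt0n; apply/card_gt0P; exists 0.
pose c b := \sum_j x 0 j * (- 2 / #|G|%:R) * chi j b.
have c_sum : \sum_(b in G) c b = 0.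
  rewrite exchange_big big1 //= => j _.
  by rewrite -mulr_sumr chi0 mulr0.
have xE : x = \sum_(b in G) c b *: emb b.
  apply/rowP => i; rewrite summxE.
  under eq_bigr do rewrite mxE chiE mulr_suml.
  rewrite exchange_big (bigD1 i) //= [X in _ + X]big1 => [|j ji].
    rewrite addr0.
    transitivity (\sum_(b in G) x 0 i * (- 1 / #|G|%:R) *
        (chi i b - chi i b * chi i b)).
      by rewrite -mulr_sumr sumrB chi0 chi_chi eqxx muln1; field.
    by apply: eq_bigr => b _; field.
  transitivity (\sum_(b in G) x 0 j * (- 1 / #|G|%:R) * (chi j b - chi j b * chi i b)).
    by apply: eq_bigr => b _; field.
  by rewrite -mulr_sumr sumrB chi0 chi_chi (negbTE ji) muln0 subrr mulr0.
(* The weights [c] sum to 0. One extra unit of weight at the origin makes the combination affine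
   without changing its value. *)
exists #|G|, (fun k => c (enum_val k) + (enum_val k == 0)%:R),
  (fun k => emb (enum_val k)).
split.
- rewrite -(big_enum_val (fun b => c b + (b == 0)%:R)) big_split /= c_sum add0r.
  rewrite (bigD1 0) //= eqxx big1 ?addr0 // => b /andP[_ /negbTE ->] //.
- by move=> k; apply/GP; exact: enum_valP.
- rewrite -(big_enum_val (fun b => (c b + (b == 0)%:R) *: emb b)) [LHS]xE.
  apply: eq_bigr => b _; have [->|_] := eqVneq b 0; first by rewrite emb0 !scaler0.
  by rewrite addr0.
Qed.

(** If a coordinate vanished on all vertices, or two agreed there, a nonzero linear form would
    vanish on the whole affine hull. The converse is the character argument. *)
Lemma has_dim_separated P : polytope P -> subgroupW (vertices P) (W n) ->
  has_dim P n <-> separated (vertices P).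
Proof.
move=> polyP subP; rewrite has_dim_full.
have coordE x i : x *m delta_mx i 0 = (x 0 i)%:M.
  by rewrite -colE; apply/rowP => k; rewrite !mxE !ord1 mulr1n.
split=> [PT|/(separated_aff_hull subP) VT].
  have sub_PV x (c : 'cV[R]_n) :
      (forall v, vertices P v -> v *m c = 0) -> x *m c = 0.
    move=> c0; apply: (aff_hull_mulmx0 (P := P)); last by rewrite PT.
    move=> y; rewrite -(conv_hull_vertices polyP) => /conv_hull_aff_hull.
    exact: aff_hull_mulmx0.
  split=> [i|i j ij]; apply: contrapT => nex.
  - have : delta_mx 0 i *m delta_mx i 0 = 0 :> 'M[R]_1.
      apply: sub_PV => v Vv; rewrite coordE.
      suff -> : v 0 i = 0 by rewrite raddf0.
      by apply: contrapT => vi; apply: nex; exists v.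
    by rewrite mul_delta_mx => /matrixP/(_ 0 0)/eqP; rewrite !mxE oner_eq0.
  - have : delta_mx 0 i *m (delta_mx i 0 - delta_mx j 0) = 0 :> 'M[R]_1.
      apply: sub_PV => v Vv; rewrite mulmxBr !coordE.
      suff -> : v 0 i = v 0 j by rewrite subrr.
      by apply: contrapT => vij; apply: nex; exists v.
    rewrite mulmxBr mul_delta_mx mul_delta_mx_0 // subr0.
    by move=> /matrixP/(_ 0 0)/eqP; rewrite !mxE oner_eq0.
apply/seteqP; split=> // x _.
have : aff_hull (vertices P) x by rewrite VT.
by move=> [m [w [p [w1 Pp ->]]]]; exists m, w, p; split=> // k; case: (Pp k).
Qed.

End Dimension.

(** * Addition modulo 2 and subgroups of index 2 *)

Lemma add_bitE (R : realType) :
  (((0 == 2 :> R) = false) * ((1 == 2 :> R) = false)) * (1 + 1 = 2 :> R).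
Proof. by rewrite eq_sym pnatr_eq0 (eqr_nat R 1 2). Qed.

Section Subgroups.
Context {R : realType} {n : nat}.
Implicit Types (U V : set 'rV[R]_n) (x y z : 'rV[R]_n).

(** Evaluates sums of bits and their comparison with 2, so that identities for [addW] reduce to a
    case check on entries. *)
Let bitE := (addr0, add0r, add_bitE R, eqxx).

Lemma addWC x y : addW x y = addW y x.
Proof. by apply/rowP => i; rewrite !mxE addrC. Qed.

Lemma addW0 x : W n x -> addW x 0 = x.
Proof.
by move=> Wx; apply/rowP => i; rewrite !mxE; case: (Wx i) => ->; rewrite !bitE.
Qed.

Lemma addWK x y : W n x -> W n y -> addW x (addW x y) = y.
Proof.
move=> Wx Wy; apply/rowP => i; rewrite !mxE.
by case: (Wx i) => ->; case: (Wy i) => ->; rewrite !bitE.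
Qed.

Lemma addWA x y z : W n x -> W n y -> W n z ->
  addW x (addW y z) = addW (addW x y) z.
Proof.
move=> Wx Wy Wz; apply/rowP => i; rewrite !mxE.
by case: (Wx i) => ->; case: (Wy i) => ->; case: (Wz i) => ->; rewrite !bitE.
Qed.

Lemma W_addW x y : W n x -> W n y -> W n (addW x y).
Proof.
move=> Wx Wy i; rewrite !mxE.
by case: (Wx i) => ->; case: (Wy i) => ->; rewrite !bitE; [left|right|right|left].
Qed.

Lemma subgroupW_intro U V : V `<=` W n -> U `<=` V -> U 0 ->
  (forall x y, U x -> U y -> U (addW x y)) -> subgroupW U V.
Proof.
move=> VW UV U0 UD; split=> // x Ux; exists x => //; exact/addWxx/VW/UV.
Qed.

(** Modulo 2, [x + u = y + ((x + y) + u)]. *)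
Lemma coset_addW U V x y : subgroupW V (W n) -> subgroupW U V -> V x -> V y ->
  U (addW x y) -> addW x @` U = addW y @` U.
Proof.
move=> [VW _ _ _] [UV _ UD _].
have sub a b : V a -> V b -> U (addW a b) -> addW a @` U `<=` addW b @` U.
  move=> Va Vb Uab _ [u Uu <-]; exists (addW (addW a b) u); first exact: UD.
  have [Wa Wb Wu] : [/\ W n a, W n b & W n u] by split; apply: VW => //; exact: UV.
  by rewrite (addWC a) -addWA // addWK //; exact: W_addW.
by move=> Vx Vy Uxy; apply/seteqP; split; apply: sub; rewrite // addWC.
Qed.

(** Replaces counting cosets by a condition on elements: it says that the indicator function of the
    complement of [U] is a nonzero homomorphism from [V] to the bits. *)
Lemma indexW2P U V : subgroupW V (W n) -> subgroupW U V ->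
  indexW V U 2 <-> (exists2 x, V x & ~ U x) /\
    (forall x y, V x -> V y -> ~ U x -> ~ U y -> U (addW x y)).
Proof.
move=> sV sU; have [VW V0 _ _] := sV; have [UV U0 UD _] := sU.
have coset_id x : V x -> (addW x @` U) x by exists 0; rewrite ?addW0 //; exact: VW.
have coset_mem x y : V x -> (addW x @` U) y -> U (addW x y).
  by move=> Vx [u Uu <-]; rewrite addWK //; [exact: VW|exact/VW/UV].
have add0W x : V x -> addW 0 x = x by move=> Vx; rewrite addWC addW0 //; exact: VW.
have coset0 x : V x -> addW x @` U = addW 0 @` U -> U x.
  by move=> Vx e; rewrite -(add0W x) //; apply: coset_mem; rewrite // -e; exact: coset_id.
split.
  move=> /eq_cardSP[C1 HC1] /eq_cardSP[C2 [HC2 C21]]; rewrite II0 card_eq0 => /eqP rest.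
  have two C : cosetsW V U C -> C = C1 \/ C = C2.
    move=> HC; apply: contrapT => /not_orP[n1 n2].
    by suff: (cosetsW V U `\ C1 `\ C2) C by rewrite rest.
  split=> [|x y Vx Vy nUx nUy].
    apply: contrapT => nex; apply: C21.
    have all0 C : cosetsW V U C -> C = addW 0 @` U.
      move=> [x Vx <-]; apply: (coset_addW sV sU) => //; rewrite addWC add0W //.
      by apply: contrapT => nUx; apply: nex; exists x.
    by rewrite (all0 _ HC1) (all0 _ HC2).
  apply: coset_mem => //.
  suff -> : addW x @` U = addW y @` U by exact: coset_id.
  have cosetV z : V z -> cosetsW V U (addW z @` U) by exists z.
  have nx : addW x @` U <> addW 0 @` U by move=> /(coset0 _ Vx).
  have ny : addW y @` U <> addW 0 @` U by move=> /(coset0 _ Vy).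
  (* There are only two cosets, and those of [x] and [y] both differ from that of 0, so they
     coincide. *)
  by case: (two _ (cosetV _ V0)) (two _ (cosetV _ Vx)) (two _ (cosetV _ Vy)) nx ny
    => -> [] -> [] -> // nx ny; case: nx ny.
move=> [[x Vx nUx] UDn].
apply/eq_cardSP; exists (addW 0 @` U); first by exists 0.
apply/eq_cardSP; exists (addW x @` U).
  by split; [exists x|move=> /(coset0 _ Vx)].
rewrite II0 card_eq0; apply/eqP/seteqP; split=> // C [[[y Vy <-] n0] nx].
case: (pselect (U y)) => Uy; [apply: n0|apply: nx]; apply: (coset_addW sV sU) => //.
  by rewrite addWC add0W.
exact: UDn.
Qed.

(** Conditions (I) and (II), expressed on the vertex set alone; this is the invariant of the
    induction. *)
Definition coord_subgroup V := subgroupW V (W n) /\ separated V.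

End Subgroups.

(** * Adding and forgetting the last coordinate *)

Section Step.
Context {R : realType} {n : nat}.
Implicit Types (x : 'rV[R]_n) (y z : 'rV[R]_n.+1) (e : R).

Definition extend x e : 'rV[R]_n.+1 :=
  \row_i (if unlift ord_max i is Some j then x 0 j else e).

Lemma drop_extend x e : drop_last (extend x e) = x.
Proof. by apply/rowP => i; rewrite !mxE liftK. Qed.

Lemma last_extend x e : last_coord (extend x e) = e.
Proof. by rewrite /last_coord mxE unlift_none. Qed.

Lemma row_last_ext y z :
  drop_last y = drop_last z -> last_coord y = last_coord z -> y = z.
Proof.
move=> /rowP d l; apply/rowP => i; case: (unliftP ord_max i) => [j ->|-> //].
by have := d j; rewrite !mxE.
Qed.

Lemma extend_drop y : extend (drop_last y) (last_coord y) = y.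
Proof. by apply: row_last_ext; rewrite ?drop_extend ?last_extend. Qed.

Lemma drop_lastE y i : y 0 (lift ord_max i) = drop_last y 0 i.
Proof. by rewrite mxE. Qed.

Lemma drop_last_mix y z t :
  drop_last ((1 - t) *: y + t *: z) = (1 - t) *: drop_last y + t *: drop_last z.
Proof. by apply/rowP => i; rewrite !mxE. Qed.

Lemma last_coord_mix y z t :
  last_coord ((1 - t) *: y + t *: z) = (1 - t) * last_coord y + t * last_coord z.
Proof. by rewrite /last_coord !mxE. Qed.

Lemma drop_last0 : drop_last 0 = 0 :> 'rV[R]_n.
Proof. by apply/rowP => i; rewrite !mxE. Qed.

Lemma last_coord0 : last_coord (0 : 'rV[R]_n.+1) = 0.
Proof. by rewrite /last_coord mxE. Qed.

Lemma drop_addW y z : drop_last (addW y z) = addW (drop_last y) (drop_last z).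
Proof. by apply/rowP => i; rewrite !mxE. Qed.

Lemma last_addW y z : last_coord (addW y z) =
  if last_coord y + last_coord z == 2 then 0 else last_coord y + last_coord z.
Proof. by rewrite /last_coord mxE. Qed.

Lemma W_drop_last y :
  W n.+1 y <-> W n (drop_last y) /\ (last_coord y = 0 \/ last_coord y = 1).
Proof.
split=> [Wy|[Wd Wl] i]; first by split=> [i|]; rewrite ?mxE; exact: Wy.
by case: (unliftP ord_max i) => [j ->|-> //]; rewrite drop_lastE.
Qed.

Definition prod_bits (S : set 'rV[R]_n) : set 'rV[R]_n.+1 :=
  [set y | S (drop_last y) /\ (last_coord y = 0 \/ last_coord y = 1)].

Lemma vertices_prod01 (P : set 'rV[R]_n) :
  vertices (prod01 P) = prod_bits (vertices P).
Proof.
apply/seteqP; split=> y.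
  move=> [[Py l01] ext]; split.
    split=> // a b t Pa Pb t01 e.
    have [||||ya yb] := ext (extend a (last_coord y)) (extend b (last_coord y)) t.
    - by split; rewrite ?drop_extend ?last_extend.
    - by split; rewrite ?drop_extend ?last_extend.
    - by [].
    - apply: row_last_ext; first by rewrite drop_last_mix !drop_extend.
      by rewrite last_coord_mix !last_extend; ring.
    by rewrite -[in LHS](drop_extend a (last_coord y))
      -[b](drop_extend b (last_coord y)) ya yb.
  apply: contrapT => /not_orP[/eqP n0 /eqP n1].
  (* At a height strictly between 0 and 1, [y] is interior to a vertical segment. *)
  have [||||y0 _] := ext (extend (drop_last y) 0) (extend (drop_last y) 1) (last_coord y).
  - by split; rewrite ?drop_extend ?last_extend ?lexx ?ler01.
  - by split; rewrite ?drop_extend ?last_extend ?lexx ?ler01.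
  - by rewrite !lt_neqAle eq_sym n0 n1.
  - apply: row_last_ext; last by rewrite last_coord_mix !last_extend; ring.
    by rewrite drop_last_mix !drop_extend -scalerDl subrK scale1r.
  by move/eqP: n0; apply; rewrite -y0 last_extend.
move=> [[Py ext] l01]; split; first by split=> //; case: l01 => ->; rewrite lexx ler01.
move=> a b t [Pa la] [Pb lb] t01 e.
have [da db] := ext _ _ t Pa Pb t01 (etrans (congr1 drop_last e) (drop_last_mix _ _ _)).
have := congr1 last_coord e; rewrite last_coord_mix => el.
by split; apply: row_last_ext => //; case: l01 => l01; rewrite l01 in el *; nra.
Qed.

(** The bottom and top copies of the hull of [S] lie in the left-hand side, and every point of the
    prism is on a vertical segment joining them. *)
Lemma conv_hull_prod_bits (S : set 'rV[R]_n) :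
  conv_hull (prod_bits S) = prod01 (conv_hull S).
Proof.
apply/seteqP; split.
  apply: conv_hull_min => [y z t [Sy ly] [Sz lz] t01|y [Sy ly]].
    split; first by rewrite drop_last_mix; exact: convex_conv_hull.
    by rewrite last_coord_mix; nra.
  split; first exact: sub_conv_hull.
  by case: ly => ->; rewrite lexx ler01.
have lift_hull e : e = 0 \/ e = 1 ->
    conv_hull S `<=` [set x | conv_hull (prod_bits S) (extend x e)].
  move=> e01; apply: conv_hull_min => [x x' t /= Sx Sx' t01|x Sx /=].
    have -> : extend ((1 - t) *: x + t *: x') e =
        (1 - t) *: extend x e + t *: extend x' e.
      apply: row_last_ext; first by rewrite drop_last_mix !drop_extend.
      by rewrite last_coord_mix !last_extend; ring.
    exact: convex_conv_hull.
  by apply: sub_conv_hull; split; rewrite ?drop_extend ?last_extend.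
move=> y [Sy ly].
have -> : y = (1 - last_coord y) *: extend (drop_last y) 0
            + last_coord y *: extend (drop_last y) 1.
  apply: row_last_ext; last by rewrite last_coord_mix !last_extend; ring.
  by rewrite drop_last_mix !drop_extend -scalerDl subrK scale1r.
by apply: convex_conv_hull => //; apply: lift_hull; auto.
Qed.

Lemma separated_last (S : set 'rV[R]_n.+1) : separated S <->
  [/\ separated (drop_last @` S), exists2 y, S y & last_coord y <> 0
    & forall i, exists2 y, S y & drop_last y 0 i <> last_coord y].
Proof.
split=> [[s1 s2]|[[s1 s2] s3 s4]].
  split.
  - split=> [i|i j ij].
      have [y Sy] := s1 (lift ord_max i); rewrite drop_lastE => yi.
      by exists (drop_last y) => //; exists y.
    have [|y Sy] := s2 (lift ord_max i) (lift ord_max j); first by rewrite (inj_eq lift_inj).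
    by rewrite !drop_lastE => yi; exists (drop_last y) => //; exists y.
  - exact: s1.
  - move=> i; have [|y Sy] := s2 (lift ord_max i) ord_max; first by rewrite eq_sym neq_lift.
    by rewrite drop_lastE => yi; exists y.
split=> [i|i j].
  case: (unliftP ord_max i) => [k ->|->]; last exact: s3.
  by have [_ [y Sy <-] yi] := s1 k; exists y; rewrite ?drop_lastE.
case: (unliftP ord_max i) => [k ->|->]; case: (unliftP ord_max j) => [l ->|->].
- rewrite (inj_eq lift_inj) => kl; have [_ [y Sy <-] yi] := s2 _ _ kl.
  by exists y; rewrite ?drop_lastE.
- by move=> _; have [y Sy yi] := s4 k; exists y; rewrite ?drop_lastE.
- move=> _; have [y Sy yi] := s4 l; exists y; rewrite ?drop_lastE //.
  exact: nesym.
- by rewrite eqxx.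
Qed.

Lemma drop_prod_bits (S : set 'rV[R]_n) : drop_last @` prod_bits S = S.
Proof.
apply/seteqP; split=> [_ [y [Sy _] <-] //|x Sx].
exists (extend x 0); rewrite ?drop_extend //.
by split; rewrite ?drop_extend ?last_extend; auto.
Qed.

Let bitE := (addr0, add0r, add_bitE R, eqxx).
Let neq10 : (1 : R) <> 0. Proof. by apply/eqP; rewrite oner_eq0. Qed.
Let neq01 : (0 : R) <> 1. Proof. exact: nesym. Qed.

(** The last unit vector, [extend 0 1], distinguishes the last coordinate from zero and from every
    other coordinate. *)
Lemma coord_subgroup_prod_bits (S : set 'rV[R]_n) :
  coord_subgroup S -> coord_subgroup (prod_bits S).
Proof.
move=> [[SW S0 SD _] sep].
have ext x e : S x -> e = 0 \/ e = 1 -> prod_bits S (extend x e).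
  by move=> Sx e01; split; rewrite ?drop_extend ?last_extend.
split.
  apply: subgroupW_intro => //.
  - by move=> y [Sy ly]; apply/W_drop_last; split=> //; exact: SW.
  - by split; rewrite ?drop_last0 ?last_coord0; auto.
  - move=> y z [Sy ly] [Sz lz]; split; first by rewrite drop_addW; exact: SD.
    by rewrite last_addW; case: ly => ->; case: lz => ->; rewrite !bitE; auto.
apply/separated_last; split; first by rewrite drop_prod_bits.
  by exists (extend 0 1); rewrite ?last_extend //; apply: ext; auto.
by move=> i; exists (extend 0 1); rewrite ?drop_extend ?last_extend ?mxE //; apply: ext; auto.
Qed.

(** For [U] of index 2 in [V], the graph of the homomorphism from [V] to the bits with kernel
    [U]. *)
Definition bits_graph (U V : set 'rV[R]_n) := preim_pi 0 U `|` preim_pi 1 (V `\` U).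

Lemma coord_subgroup_bits_graph (U V : set 'rV[R]_n) :
  coord_subgroup V -> subgroupW U V -> indexW V U 2 ->
  (forall i, U <> V `&` hyperplane0 i) -> coord_subgroup (bits_graph U V).
Proof.
move=> [sV sep] sU /(indexW2P sV sU)[[x0 Vx0 nUx0] UDn] Ui.
have [VW V0 VD _] := sV; have [UV U0 UD _] := sU.
(* By cancellation, an element of [U] plus an element of [V] outside [U] stays outside [U]. *)
have UDl x x' : V x -> U x' -> U (addW x x') -> U x.
  move=> Vx Ux' H; have -> : x = addW x' (addW x x').
    by rewrite (addWC x) addWK //; [exact/VW/UV|exact: VW].
  exact: UD.
have graph x : V x -> exists2 y, bits_graph U V y &
    drop_last y = x /\ (last_coord y = 0 <-> U x).
  move=> Vx; case: (pselect (U x)) => Ux.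
    by exists (extend x 0); [left; split|]; rewrite ?drop_extend ?last_extend.
  by exists (extend x 1); [right; split|]; rewrite ?drop_extend ?last_extend.
split.
  apply: subgroupW_intro => //.
  - move=> y [[ly Uy]|[ly [Vy _]]]; apply/W_drop_last.
      by split; [exact/VW/UV|left].
    by split; [exact: VW|right].
  - by left; split; rewrite ?last_coord0 ?drop_last0.
  - move=> y z [[ly Uy]|[ly [Vy nUy]]] [[lz Uz]|[lz [Vz nUz]]];
      rewrite /bits_graph /preim_pi /= last_addW drop_addW ly lz !bitE.
    + by left; split=> //; exact: UD.
    + right; split=> //; split; first by apply: VD => //; exact: UV.
      by rewrite addWC => /(UDl _ _ Vz Uy).
    + right; split=> //; split; first by apply: VD => //; exact: UV.
      by move=> /(UDl _ _ Vy Uz).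
    + by left; split=> //; exact: UDn.
apply/separated_last; split.
- rewrite (_ : drop_last @` _ = V) //; apply/seteqP; split.
    by move=> _ [y [[_ /UV Vy]|[_ [Vy _]]] <-].
  by move=> x /graph[y Gy [yx _]]; exists y.
- by have [y Gy [_ yU]] := graph _ Vx0; exists y => // /yU.
- move=> i; apply: contrapT => nex; apply: (Ui i).
  (* Without a separating point, coordinate [i] equals the last one on the graph, so its zero set in
     [V] is [U]. *)
  have coord x : V x -> x 0 i = 0 <-> U x.
    move=> /graph[y Gy [yx <-]]; suff -> : x 0 i = last_coord y by [].
    by rewrite -yx; apply: contrapT => yi; apply: nex; exists y.
  apply/seteqP; split=> [x Ux|x [Vx xi]]; last exact/(coord _ Vx).
  by split; [exact: UV|apply/coord => //; exact: UV].
Qed.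

Lemma coord_subgroup_drop (S : set 'rV[R]_n.+1) :
  coord_subgroup S -> coord_subgroup (drop_last @` S).
Proof.
move=> [[SW S0 SD _] /separated_last[sep _ _]]; split=> //.
apply: subgroupW_intro => //.
- by move=> _ [y /SW/W_drop_last[Wy _] <-].
- by exists 0; rewrite ?drop_last0.
- by move=> _ _ [y Sy <-] [z Sz <-]; exists (addW y z); rewrite ?drop_addW //; exact: SD.
Qed.

Lemma coord_subgroup_inv (S : set 'rV[R]_n.+1) (V := drop_last @` S) :
  coord_subgroup S ->
  S = prod_bits V \/ exists U, [/\ subgroupW U V, indexW V U 2,
    forall i, U <> V `&` hyperplane0 i & S = bits_graph U V].
Proof.
move=> gS; have [sV _] : coord_subgroup V by exact: coord_subgroup_drop.
have [[SW S0 SD _] /separated_last[_ [y1 Sy1 ly1] sep]] := gS.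
have [VW V0 VD _] := sV.
have bit y : S y -> last_coord y = 0 \/ last_coord y = 1.
  by move=> /SW/W_drop_last[].
pose e1 := extend 0 1.
(* Adding [e1] flips the last bit only; so if [e1] is in [S], both lifts of every point of [V] are
   in [S]. *)
have addW_e1 y : S y -> drop_last (addW y e1) = drop_last y /\
    last_coord (addW y e1) = 1 - last_coord y.
  move=> Sy; rewrite drop_addW last_addW drop_extend last_extend addW0; last first.
    by apply: VW; exists y.
  by case: (bit _ Sy) => ->; rewrite !bitE ?subr0 ?subrr.
case: (pselect (S e1)) => Se1.
  left; apply/seteqP; split=> [y Sy|y [[z Sz zy] ly]].
    by split; [exists y|exact: bit].
  case: (pselect (last_coord z = last_coord y)) => zyl.
    by rewrite -(row_last_ext zy zyl).
  have [d l] := addW_e1 _ Sz.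
  rewrite (_ : y = addW z e1); first exact: SD.
  apply: row_last_ext; first by rewrite d.
  by rewrite l; case: ly (bit _ Sz) zyl => -> [] -> // _; rewrite ?subr0 ?subrr.
right.
(* Two points of [S] differing only in the last bit would sum to [e1]. Hence [S] is the graph of a
   function on [V], and [U] below is its zero set. *)
have inj y z : S y -> S z -> drop_last y = drop_last z -> last_coord y = last_coord z.
  move=> Sy Sz yz; apply: contrapT => nl; apply: Se1.
  rewrite (_ : e1 = addW y z); first exact: SD.
  apply: row_last_ext; rewrite ?drop_addW ?last_addW ?drop_extend ?last_extend.
    by rewrite yz addWxx //; apply: VW; exists z.
  by case: (bit _ Sy) (bit _ Sz) nl => -> [] ->; rewrite !bitE.
pose U := [set x | S (extend x 0)].
have US y : S y -> U (drop_last y) <-> last_coord y = 0.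
  move=> Sy; split=> [Uy|ly]; last by rewrite /U /= -ly extend_drop.
  by rewrite (inj _ _ Sy Uy) ?drop_extend ?last_extend.
have sU : subgroupW U V.
  apply: subgroupW_intro => //.
  - by move=> x Ux; exists (extend x 0) => //; exact: drop_extend.
  - by rewrite -drop_last0; apply/US => //; exact: last_coord0.
  - move=> x x' Ux Ux'; have := SD _ _ Ux Ux' => /US.
    by rewrite drop_addW last_addW !last_extend !drop_extend !bitE => H; exact/H.
have nUS y : S y -> ~ U (drop_last y) -> last_coord y = 1.
  by move=> Sy nUy; case: (bit _ Sy) => // ly; case: nUy; exact/US.
exists U; split=> //.
- apply/(indexW2P sV sU); split.
    by exists (drop_last y1); [exists y1|move=> /(US _ Sy1)].
  move=> _ _ [y Sy <-] [z Sz <-] nUy nUz; rewrite -drop_addW; apply/US; first exact: SD.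
  by rewrite last_addW (nUS _ Sy) // (nUS _ Sz) // !bitE.
(* If [U] were the zero set of coordinate [i], that coordinate would agree with the last one on [S],
   against separation. *)
- move=> i UE; have [y Sy yi] := sep i; apply: yi.
  have UyE : U (drop_last y) <-> drop_last y 0 i = 0.
    by rewrite UE; split=> [[]//|yi]; split=> //; exists y.
  have Wi : W n (drop_last y) by apply: VW; exists y.
  case: (bit _ Sy) => ly; rewrite ly; first by apply/UyE/US.
  by case: (Wi i) => // /UyE/(US _ Sy); rewrite ly => /neq10.
- apply/seteqP; split=> y.
    move=> Sy; case: (bit _ Sy) => ly; [left|right]; split=> //; first exact/US.
    by split; [exists y|move=> /(US _ Sy); rewrite ly].
  move=> [[ly Uy]|[ly [[z Sz zy] nUy]]]; first by rewrite -(extend_drop y) ly.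
  by rewrite (_ : y = z) //; apply: row_last_ext; rewrite // ly nUS // zy.
Qed.

End Step.

(** * Induction on the dimension *)

(** Separation forces the point 1 into the vertex set and the subgroup condition gives 0, so the
    vertex set is all of [W 1], whose hull is the unit interval. *)
Lemma frakP1 (R : realType) (P : set 'rV[R]_1) :
  frakP R 1 P <-> polytope P /\ coord_subgroup (vertices P).
Proof.
have W0 : W 1 (0 : 'rV[R]_1) by move=> i; rewrite mxE; left.
have W1 : W 1 (const_mx 1 : 'rV[R]_1) by move=> i; rewrite mxE; right.
have W01 (x : 'rV[R]_1) : W 1 x -> x = 0 \/ x = const_mx 1.
  by move=> /(_ 0)[] x0; [left|right]; apply/rowP => i; rewrite !mxE ord1 x0.
have one0 : (1 : R) <> 0 by apply/eqP; rewrite oner_eq0.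
have good : coord_subgroup (@W R 1).
  split; first by apply: subgroupW_intro => // x y; exact: W_addW.
  split=> [i|i j]; last by rewrite !ord1.
  by exists (const_mx 1) => //; rewrite mxE.
have hullW : conv_hull (@W R 1) = [set x : 'rV[R]_1 | 0 <= x 0 0 <= 1].
  apply/seteqP; split.
    apply: conv_hull_min => [x y t /= Hx Hy t01|x /(_ 0) /= [] ->]; rewrite ?lexx ?ler01 //.
    by rewrite !mxE; nra.
  move=> x /= x01.
  have -> : x = (1 - x 0 0) *: 0 + x 0 0 *: const_mx 1.
    by apply/rowP => i; rewrite !mxE !ord1; ring.
  by apply: convex_conv_hull => //; exact: sub_conv_hull.
rewrite /= -hullW; split=> [->|[polyP [[VW V0 _ _] [sep _]]]].
  by split; [exact: polytope_conv_hullW|rewrite vertices_conv_hullW].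
rewrite -(conv_hull_vertices polyP); congr conv_hull; apply/seteqP; split=> //.
have [x Vx x0] := sep 0.
move=> y /W01[->//|->]; case: (W01 _ (VW _ Vx)) => xE; last by rewrite -xE.
by move: x0; rewrite xE mxE.
Qed.

Lemma frakP_coord_subgroup (R : realType) n (P : set 'rV[R]_n.+1) :
  frakP R n.+1 P <-> polytope P /\ coord_subgroup (vertices P).
Proof.
elim: n P => [|n IH] Q; first exact: frakP1.
split.
  move=> [polyQ [P /IH[polyP gP] []]].
    by move=> QE; rewrite {2}QE vertices_prod01; split=> //; exact: coord_subgroup_prod_bits.
  by move=> [_ [U [sU iU Ui ->]]]; split=> //; exact: coord_subgroup_bits_graph.
move=> [polyQ gQ]; split=> //.
have gV := coord_subgroup_drop gQ; set V := drop_last @` _ in gV.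
have VW : V `<=` W n.+1 by case: gV => -[].
(* The predecessor of [Q] is the hull of its projected vertices; these are 0/1-points, so they are
   exactly its vertices. *)
exists (conv_hull V).
  by apply/IH; rewrite vertices_conv_hullW //; split=> //; exact: polytope_conv_hullW.
have [QV|[U [sU iU Ui QU]]] := coord_subgroup_inv gQ; [left|right].
  (* [Q] and the prism are hulls of the same vertex set. *)
  by rewrite -conv_hull_prod_bits -[prod_bits _]QV conv_hull_vertices.
split; first by split=> //; case: gQ => -[].
by exists U; rewrite vertices_conv_hullW.
Qed.

Theorem theorem15 (R : realType) (n : nat) (hn : (1 <= n)%N) :
  frakP R n =
  [set P : set 'rV[R]_n |
    polytope01 P /\ subgroupW (vertices P) (W n) /\ has_dim P n].
Proof.
case: n hn => // n _; apply/seteqP; split=> P.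
  move=> /frakP_coord_subgroup[polyP [sP sepP]].
  by split; [split=> //; case: sP|split=> //; exact/has_dim_separated].
move=> [[polyP _] [sP dimP]]; apply/frakP_coord_subgroup; split=> //.
by split=> //; exact/has_dim_separated.
Qed.
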